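(* Let $A$ be a finite set of real numbers and let $f:\mathbb{R}\to\mathbb{R}$ be a convex function (in the sense defined in the context). Then \[ |A+A-A|\,|f(A)+f(A)-f(A)| \gg |A|^3, \] where the implied constant is absolute.
   Context: For $k\ge 0$, a function $f:\mathbb{R}\to\mathbb{R}$ of class $C^k$ is called $k$-convex if each of its derivatives $f^{(0)}=f, f^{(1)},\dots,f^{(k)}$ is strictly monotone (each either strictly increasing or strictly decreasing). A convex function means a $1$-convex function. For sets $X,Y\subseteq\mathbb{R}$, $X+Y=\{x+y:x\in X,y\in Y\}$, $X-Y=\{x-y\}$, and $f(A)=\{f(a):a\in A\}$; thus $A+A-A=\{a+a'-a'':a,a',a''\in A\}$. The notation $X\gg Y$ means $X\ge cY$ for an absolute constant $c>0$. *)

(* Defs.v *)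
From HB Require Import structures.
From mathcomp Require Import all_boot all_order all_algebra finmap.
From mathcomp Require Import all_classical all_reals all_analysis.
Set Implicit Arguments.
Unset Strict Implicit.
Unset Printing Implicit Defensive.
Import Order.TTheory GRing.Theory Num.Theory.
Import numFieldNormedType.Exports.
Local Open Scope classical_set_scope.
Local Open Scope ring_scope.

Definition sumset (R : realType) (X Y : {fset R}) : {fset R} :=
  [fset (x + y)%R | x in X, y in Y]%fset.

Definition diffset (R : realType) (X Y : {fset R}) : {fset R} :=
  [fset (x - y)%R | x in X, y in Y]%fset.

Definition fset_image (R : realType) (f : R -> R) (A : {fset R}) : {fset R} :=
  [fset f x | x in A]%fset.

Definition class_C (R : realType) (k : nat) (f : R -> R) : Prop :=
  (forall (i : nat) (x : R), (i < k)%N -> derivable (derive1n i f) x 1) /\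
  (forall i : nat, (i <= k)%N -> continuous (derive1n i f)).

Definition strictly_monotone (R : realType) (f : R -> R) : Prop :=
  {homo f : x y / x < y} \/ {homo f : x y /~ x < y}.

Definition kconvex (R : realType) (k : nat) (f : R -> R) : Prop :=
  class_C k f /\
  (forall i : nat, (i <= k)%N -> strictly_monotone (derive1n i f)).

(* This is not [convex_function]: a decreasing derivative is allowed, and both
   the function and its derivative have to be strictly monotone. *)
Definition convex_fun (R : realType) (f : R -> R) : Prop := kconvex 1 f.

(* Main.v *)
Require Import Defs.
From mathcomp Require Import all_boot all_order all_algebra finmap.
From mathcomp Require Import all_classical all_reals all_analysis.
From mathcomp Require Import zify lra.
Import Order.TTheory GRing.Theory Num.Theory.
Import numFieldNormedType.Exports.
Local Open Scope ring_scope.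

(** After replacing f by -f, let f be increasing, and list A as a_0 < ... < a_m
    with gaps d_i = a_(i+1) - a_i and D_i = f(a_(i+1)) - f(a_i).
    A gap d_i <= d_j puts a_j + d_i in (a_j, a_(j+1)], so these disjoint intervals
    bound, on average over j, the number of distinct gaps that are at most d_j by
    |A+A-A| / m. By Markov, half of the indices carry only O(|A+A-A| / m) distinct
    gaps, and by Cauchy-Schwarz m^3 is O(|A+A-A| E), where E is the number of pairs
    (i, j) with d_i = d_j. As f' is strictly monotone, x |-> f(x + d) - f(x) is
    injective, so for fixed d_j the D_i with d_i = d_j are distinct. Those with
    D_i <= D_j squeeze f(a_j) + D_i into (f(a_j), f(a_(j+1))], and every pair or its
    swap qualifies, whence E <= 2 |f(A)+f(A)-f(A)|. *)

(** * Cauchy-Schwarz and the energy of a finite family *)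

Lemma sqr_sum_leq_size (T : Type) (V : seq T) (a : T -> nat) :
  ((\sum_(v <- V) a v) ^ 2 <= size V * \sum_(v <- V) a v ^ 2)%N.
Proof.
elim: V => [|v V IH]; first by rewrite !big_nil.
rewrite !big_cons /=.
(* The mixed terms of the square, bounded by 2xy <= x^2 + y^2 for each [u]. *)
have cross : (2 * (a v * \sum_(u <- V) a u)
              <= size V * a v ^ 2 + \sum_(u <- V) a u ^ 2)%N.
  elim: V {IH} => [|u V IH]; first by rewrite !big_nil !muln0.
  by rewrite !big_cons /=; have := (nat_Cauchy (a v) (a u)).1; lia.
by rewrite sqrnD mulSn mulnDr; lia.
Qed.

Lemma sum_fibers (I : finType) (T : eqType) (d : I -> T) (G : {set I})
    (F : T -> nat) :
  (\sum_(i in G) F (d i) =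
   \sum_(v <- undup [seq d i | i in G]) #|[set i in G | d i == v]| * F v)%N.
Proof.
have step i : i \in G ->
    F (d i) = (\sum_(v <- undup [seq d i | i in G]) (d i == v) * F v)%N.
  move=> iG; have dV := fintype.image_f d iG.
  rewrite (bigD1_seq (d i)) ?undup_uniq ?mem_undup //=.
  rewrite eqxx mul1n big1 ?addn0 // => v /negPf; rewrite eq_sym => ->.
  by rewrite mul0n.
rewrite (eq_bigr _ step) exchange_big /=; apply: eq_bigr => v _.
rewrite -big_distrl /=; congr (_ * _)%N.
by rewrite -sum1dep_card big_mkcondr /=; apply: eq_bigr => i _; case: eqP.
Qed.

(** Cauchy-Schwarz over the fibres of [d] on [G]: the fibre sizes add up to #|G| and their squares
    to the energy. *)
Lemma sqr_card_leq_energy (I : finType) (T : eqType) (d : I -> T)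
    (G : {set I}) :
  (#|G| ^ 2 <= size (undup [seq d i | i in G]) *
               \sum_(i in G) #|[set j in G | d j == d i]|)%N.
Proof.
rewrite -sum1_card (sum_fibers _ _ d G (fun=> 1%N)).
rewrite (sum_fibers _ _ d G (fun v => #|[set j in G | d j == v]|)).
under eq_bigr do rewrite muln1.
exact: sqr_sum_leq_size.
Qed.

(** Repetitions are removed because equal gaps translate a point to the same place. *)
Definition values_below {R : realType} {I : finType} (d : I -> R) (j : I) :=
  undup [seq d i | i in [pred i | d i <= d j]].

Lemma cube_card_leq_energy (R : realType) (I : finType) (d : I -> R) (S : nat) :
  (\sum_j size (values_below d j) <= S)%N ->
  (#|I| ^ 3 <= 8 * S * \sum_i #|[set j | d j == d i]|)%N.
Proof.
move=> hS; set m := #|I|.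
(* The threshold is twice the average S / m, multiplied out to stay in [nat]; by Markov, [G] holds
   at least half of the indices. *)
pose G := [set j | size (values_below d j) * m <= 2 * S]%N.
have hG : (m <= 2 * #|G|)%N.
  have bad : ((2 * S).+1 * #|~: G| <= S * m)%N.
    rewrite mulnC -sum_nat_const.
    apply: (@leq_trans (\sum_j size (values_below d j) * m)).
      rewrite [leqRHS](bigID (mem (~: G))) /=; apply: leq_trans (leq_addr _ _).
      by apply: leq_sum => j; rewrite !inE -ltnNge.
    by rewrite -big_distrl leq_mul2r hS orbT.
  have := cardsC G; rewrite -/m; nia.
(* All values on [G] are at most the one at a maximizing [j] in [G], so the threshold at this single
   [j] bounds their number. *)
have hk : (size (undup [seq d i | i in G]) * m <= 2 * S)%N.
  case: (set_0Vmem G) => [->|[j0 j0G]].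
    by rewrite /image_mem enum_set0.
  have [j] := @arg_maxP _ _ _ j0 (mem G) d j0G => jG jmax.
  have: j \in G by []; rewrite inE => {}jG.
  apply: leq_trans jG; rewrite leq_mul2r; apply/orP; right.
  apply: uniq_leq_size; first exact: undup_uniq.
  move=> v; rewrite !mem_undup => /fintype.imageP[i iG ->].
  by apply: fintype.image_f; rewrite inE; apply: jmax.
have := sqr_card_leq_energy _ _ d G.
set k := size _ in hk *; set E := (\sum_(i in G) _)%N => hE.
have EE : (E <= \sum_i #|[set j | d j == d i]|)%N.
  rewrite [leqRHS](bigID (mem G)) /=; apply: leq_trans (leq_addr _ _).
  apply: leq_sum => i _; apply: subset_leq_card; apply/fintype.subsetP => j.
  by rewrite !inE => /andP[].
apply: leq_trans (leq_mul (leqnn (8 * S)) EE).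
(* The 8 is 4, from m <= 2 #|G| squared, times 2 from the threshold. *)
apply: (@leq_trans (4 * (#|G| ^ 2 * m))).
  have : (m ^ 2 * m <= (2 * #|G|) ^ 2 * m)%N.
    by rewrite leq_mul2r leq_exp2r ?hG ?orbT.
  by rewrite expnMn; lia.
apply: (@leq_trans (4 * (k * E * m))).
  by rewrite leq_mul2l leq_mul2r hE orbT.
by have := leq_mul hk (leqnn E); lia.
Qed.

(** * Counting in disjoint intervals *)

(** The half-open intervals are disjoint, so concatenating the [s j] gives a duplicate-free list
    inside [X]. *)
Lemma sum_leq_of_intervals (R : realType) (m : nat) (b : nat -> R)
    (X : {fset R}) (s : 'I_m -> seq R) :
  (forall i j, (i <= j <= m)%N -> b i <= b j) ->
  (forall j, uniq (s j)) ->
  (forall j x, x \in s j -> x \in X /\ b j < x <= b j.+1) ->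
  (\sum_j size (s j) <= #|` X|)%N.
Proof.
move=> bmono us sX.
have -> : (\sum_j size (s j) = size (flatten [seq s j | j : 'I_m]))%N.
  rewrite size_flatten /shape sumnE -map_comp big_map.
  by rewrite big_enum.
apply: uniq_leq_size; last first.
  by move=> x /flatten_mapP[j _ /sX[]].
have: uniq (enum 'I_m) by exact: enum_uniq.
rewrite /image_mem; elim: (enum 'I_m) => //= j r IH /andP[jr ur].
rewrite cat_uniq us IH // andbT.
apply/hasPn => x /flatten_mapP[i ir xi]; apply/negP => xj.
have [_ /andP[i1 i2]] := sX _ _ xi; have [_ /andP[j1 j2]] := sX _ _ xj.
have := ltn_ord i; have := ltn_ord j.
case: (ltngtP i j) => ij hj hi.
- have := bmono i.+1 j; rewrite ij ltnW // => /(_ isT); lra.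
- have := bmono j.+1 i; rewrite ij ltnW // => /(_ isT); lra.
- by move: jr; rewrite -(val_inj ij) ir.
Qed.

(** Translating [s j] by [b j] moves it into the j-th interval, and b_j + b_(i+1) - b_i lies in
    B+B-B. It serves both for the points of A and for their images under f. *)
Lemma sum_increments_leq (R : realType) (m : nat) (b : nat -> R)
    (B : {fset R}) (s : 'I_m -> seq R) :
  (forall i, (i <= m)%N -> b i \in B) ->
  (forall i j, (i < j <= m)%N -> b i < b j) ->
  (forall j, uniq (s j)) ->
  (forall j x, x \in s j ->
     x <= b j.+1 - b j /\ exists i : 'I_m, x = b i.+1 - b i) ->
  (\sum_j size (s j) <= #|` diffset (sumset B B) B|)%N.
Proof.
move=> bB bmono us sb.
have -> : (\sum_j size (s j) =
    \sum_(j < m) size [seq (b j + x)%R | x <- s j])%N.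
  by apply: eq_bigr => j _; rewrite size_map.
apply: (@sum_leq_of_intervals R m b _ (fun j => [seq b j + x | x <- s j]))
  => [i j /andP[]|j|j _ /mapP[x /sb[xle [i xi]] ->]].
- by rewrite leq_eqVlt => /predU1P[->//|ij jm]; rewrite ltW// bmono// ij.
- by rewrite map_inj_uniq //; exact: addrI.
have pos : 0 < x by rewrite xi subr_gt0 bmono // ltnSn ltn_ord.
split; last lra.
rewrite xi addrA; apply: in_imfset2; last by apply: bB; exact: ltnW.
by apply: in_imfset2; apply: bB => //; exact: ltnW.
Qed.

(** * The inequality for an increasing function *)

Lemma cube_card_leq_increasing (R : realType) (A : {fset R}) (f : R -> R) :
  {homo f : x y / x < y} ->
  (forall h, 0 < h -> injective (fun x => f (x + h) - f x)) ->
  (#|` A| ^ 3 <= 128 * (#|` diffset (sumset A A) A| *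
     #|` diffset (sumset (fset_image f A) (fset_image f A))
                 (fset_image f A)|))%N.
Proof.
move=> finc finj; set S := #|` diffset _ A|; set T := #|` diffset _ _|.
pose a i := nth 0 (sort <=%R A) i.
have srt : sorted <%R (sort <=%R A) by rewrite sort_lt_sorted fset_uniq.
have sz : size (sort <=%R A) = #|` A| by rewrite size_sort.
case En : #|` A| => [//|m].
have aA i : (i <= m)%N -> a i \in A.
  by move=> im; rewrite -(mem_sort <=%R) mem_nth // sz En.
have ainc i j : (i < j <= m)%N -> a i < a j.
  move=> /andP[ij jm]; rewrite lt_sorted_ltn_nth // inE sz En //.
  exact: ltn_trans ij _.
pose d (i : 'I_m) := a i.+1 - a i; pose D (i : 'I_m) := f (a i.+1) - f (a i).
have dpos i : 0 < d i by rewrite subr_gt0 ainc // ltnSn ltn_ord.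
have hS : (\sum_j size (values_below d j) <= S)%N.
  apply: (@sum_increments_leq R m a) => // [j|j x].
    exact: undup_uniq.
  rewrite mem_undup => /fintype.imageP[i]; rewrite inE => dij ->; split=> //.
  by exists i.
have Dinj i j : d i = d j -> D i = D j -> i = j.
  move=> dij; have D' k : D k = f (a k + d k) - f (a k) by rewrite /D /d subrKC.
  rewrite !D' dij => /(finj _ (dpos j)) aij; apply/val_inj => /=.
  have := ltn_ord i; have := ltn_ord j.
  case: (ltngtP i j) => // ij hj hi.
    by have := ainc i j; rewrite ij aij ltxx ltnW // => /(_ isT).
  by have := ainc j i; rewrite ij aij ltxx ltnW // => /(_ isT).
(* By [Dinj], indices with the same gap have distinct [D], so counting these indices is counting
   increments of f along A. *)
have hT : (\sum_j #|[set i | (d i == d j) && (D i <= D j)%R]| <= T)%N.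
  have -> : (\sum_(j < m) #|[set i | (d i == d j) && (D i <= D j)%R]| =
      \sum_(j < m)
        size [seq D i | i in [set i | (d i == d j) && (D i <= D j)%R]])%N.
    by apply: eq_bigr => j _; rewrite size_image.
  apply: (@sum_increments_leq R m (f \o a) _
    (fun j => [seq D i | i in [set i | (d i == d j) && (D i <= D j)]]))
    => [i im|i j ij|j|j x /fintype.imageP[i]].
  - by apply: in_imfset; exact: aA.
  - by apply: finc; exact: ainc.
  - rewrite map_inj_in_uniq ?enum_uniq // => i i'.
    rewrite !mem_enum !inE => /andP[/eqP di _] /andP[/eqP di' _].
    by apply: Dinj; rewrite di di'.
  - by rewrite inE => /andP[_ Dij] ->; split=> //; exists i.
(* Of (i, j) and (j, i) at least one has its first [D] at most its second; exchanging the two sums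
   in one copy of [hT] accounts for the swap. *)
have hE : (\sum_j #|[set i | d i == d j]| <= 2 * T)%N.
  have cardE (P : pred ('I_m * 'I_m)) :
      (\sum_j #|[set i | P (i, j)]| = \sum_j \sum_i P (i, j))%N.
    apply: eq_bigr => j _; rewrite -sum1dep_card big_mkcond /=.
    by apply: eq_bigr => i _; case: (P _).
  move: hT; rewrite (cardE (fun p => d p.1 == d p.2)).
  rewrite (cardE (fun p => (d p.1 == d p.2) && (D p.1 <= D p.2))) /= => hT.
  rewrite mul2n -addnn; apply: leq_trans (leq_add hT hT).
  rewrite [X in (_ <= _ + X)%N]exchange_big /= -big_split /=.
  apply: leq_sum => j _; rewrite -big_split /=; apply: leq_sum => i _.
  rewrite (eq_sym (d j)); case: (d i == d j) => //.
  by case: (leP (D i) (D j)) => // /ltW ->.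
have := cube_card_leq_energy _ _ d _ hS; rewrite card_ord => hm.
have m3 : (m ^ 3 <= 16 * (S * T))%N.
  by apply: (leq_trans hm); apply: leq_trans (leq_mul (leqnn _) hE) _; nia.
(* A has m + 1 points: for m > 0, (m + 1)^3 <= 8 m^3 turns 16 into 128. A single point only needs
   [S] and [T] positive. *)
case: (posnP m) => [m0|m0]; last first.
  apply: (@leq_trans ((2 * m) ^ 3)); first by rewrite leq_exp2r //; lia.
  by rewrite expnMn; lia.
have pos (B : {fset R}) x : x \in B -> (0 < #|` diffset (sumset B B) B|)%N.
  move=> xB; rewrite cardfs_gt0; apply/fset0Pn; exists (x + x - x).
  by apply: in_imfset2 => //; apply: in_imfset2.
have S0 : (0 < S)%N by apply: (pos _ (a 0)); exact: aA.
have T0 : (0 < T)%N by apply: (pos _ (f (a 0))); apply: in_imfset; exact: aA.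
by rewrite m0 exp1n; nia.
Qed.

(** * Passing to -f, and injectivity of increments *)

Lemma card_sumdiff_opp (R : realType) (B : {fset R}) :
  #|` diffset (sumset (fset_image -%R B) (fset_image -%R B)) (fset_image -%R B)|
  = #|` diffset (sumset B B) B|.
Proof.
transitivity #|` fset_image -%R (diffset (sumset B B) B)|; last first.
  by rewrite card_imfset //; exact: oppr_inj.
congr #|` _|; apply/fsetP => z; apply/idP/idP.
  move=> /imfset2P[_ /imfset2P[_ /imfsetP[x /= xB ->]
    [_ /imfsetP[y /= yB ->] ->]]] [_ /imfsetP[w /= wB ->] ->].
  apply/imfsetP; exists (x + y - w); last by rewrite !opprD.
  by apply: in_imfset2 => //; apply: in_imfset2.
move=> /imfsetP[_ /imfset2P[_ /imfset2P[x xB [y yB ->]] [w wB ->]] ->].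
rewrite opprB addrC opprD -[X in _ + X]opprK.
apply: in_imfset2; last exact: in_imfset.
by apply: in_imfset2; exact: in_imfset.
Qed.

(** Two equal increments would give, by Rolle, a point c with f'(c + h) = f'(c), against strict
    monotonicity of f'. *)
Lemma convex_increment_inj (R : realType) (f : R -> R) (h : R) :
  convex_fun f -> 0 < h -> injective (fun x => f (x + h) - f x).
Proof.
move=> [[fder _] fmono] h0.
have df (x : R) : is_derive x 1 f (derive1 f x).
  by rewrite derive1E; apply: derivableP; exact: (fder 0%N).
have dg (x : R) : is_derive x 1 (fun x => f (x + h) - f x)
    (derive1 f (x + h) - derive1 f x).
  apply: is_deriveB.
  have dh : is_derive x 1 (fun x : R => x + h) 1.
    by apply: is_derive_eq; rewrite addr0.
  have := @is_derive1_comp R f (fun y => y + h) x _ _ (df (x + h)) dh.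
  by rewrite mulr1.
have noeq (x y : R) : x < y -> f (x + h) - f x = f (y + h) - f y -> False.
  move=> xy e.
  have [||c _ dc] := @Rolle R (fun z => f (z + h) - f z) x y xy _ _ e.
  - by move=> z _; have [] := dg z.
  - by apply: derivable_within_continuous => z _; have [] := dg z.
  have [_ e1] := dg c; have [_ e2] := dc.
  have := fmono 1%N (leqnn _); rewrite derive1n1.
  have cch : c < c + h by rewrite ltrDl.
  by case=> /(_ _ _ cch) /=; lra.
by move=> x y /= e; case: (ltgtP x y) => // xy; case: (noeq _ _ xy).
Qed.

Theorem theorem1p1 (R : realType) :
  exists c : R, 0 < c /\
    forall (A : {fset R}) (f : R -> R), convex_fun f ->
      c * #|` A|%:R ^+ 3 <=
      #|` diffset (sumset A A) A|%:R *
      #|` diffset (sumset (fset_image f A) (fset_image f A))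
                  (fset_image f A)|%:R.
Proof.
exists 128^-1; split; first by rewrite invr_gt0.
move=> A f fconv.
rewrite ler_pdivrMl // -natrX -!natrM ler_nat.
have finj h : 0 < h -> injective (fun x => f (x + h) - f x).
  exact: convex_increment_inj.
have [finc|fdec] := fconv.2 0%N isT; first exact: cube_card_leq_increasing.
(* For decreasing f, the function -f is increasing, its increments are the negatives of those of f,
   and the image set is negated, which keeps the cardinality. *)
have := @cube_card_leq_increasing R A (-%R \o f).
have -> : fset_image (-%R \o f) A = fset_image -%R (fset_image f A).
  apply/fsetP => z; apply/imfsetP/imfsetP.
    move=> [x /= xA ->]; exists (f x) => //; exact: in_imfset.
  by move=> [_ /imfsetP[x /= xA ->] ->]; exists x.
rewrite card_sumdiff_opp; apply.
  by move=> x y xy /=; rewrite ltrN2; exact: fdec.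
move=> h h0 x y /= e; apply: (finj h h0) => /=; lra.
Qed.
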